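(* If $\mathfrak{r}_{\omega_1} \ge \mathfrak{d}_{\omega_1}$, then there is a dichotomous $\mathcal{B}$ such that $\mathcal{A} \subset \mathcal{B} \subset \mathcal{P}(\omega_1)$ and $|\mathcal{B}| = \mathfrak{d}_{\omega_1}$ and $\mathrm{Irr}_{\mathrm{mm}}(\mathcal{B}) \ge \mathfrak{b}_{\omega_1}$.
   Context: $\mathcal{A}$ denotes the finite-cofinite algebra on $\omega_1$ (all finite or cofinite subsets of $\omega_1$). For boolean algebras, $\mathcal{B} \subseteq \mathcal{C}$ means that $\mathcal{B}$ is a sub-algebra of $\mathcal{C}$, and $\mathcal{B} \subset \mathcal{C}$ means that it is a proper sub-algebra. $\mathcal{B}$ is dichotomous iff $\mathcal{B}$ is a sub-algebra of $\mathcal{P}(\omega_1)$, $\mathcal{A} \subseteq \mathcal{B}$, and for all $b \in \mathcal{B}$, either $b \in \mathcal{A}$ or $|b| = |\omega_1 \setminus b| = \aleph_1$. For $\mathcal{E} \subseteq \mathcal{B}$, $\mathrm{sa}(\mathcal{E})$ is the sub-algebra of $\mathcal{B}$ generated by $\mathcal{E}$. $\mathcal{E}$ is irredundant iff $a \notin \mathrm{sa}(\mathcal{E}\setminus\{a\})$ for all $a \in \mathcal{E}$; a maximal irredundant subset of $\mathcal{B}$ is an irredundant subset not properly contained in any irredundant subset of $\mathcal{B}$. $\mathrm{Irr}_{\mathrm{mm}}(\mathcal{B})$ is the minimum size of a maximal irredundant subset of $\mathcal{B}$. For $f,g \in \omega_1^{\omega_1}$ (functions from $\omega_1$ to $\omega_1$),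 $f \le^* g$ iff $\{\xi : f(\xi) > g(\xi)\}$ is countable. $\mathfrak{b}_{\omega_1}$ is the least size of a family in $\omega_1^{\omega_1}$ that is unbounded with respect to $\le^*$ (no single $g$ satisfies $f \le^* g$ for all $f$ in the family). $\mathfrak{d}_{\omega_1}$ is the least size of a dominating family (every $f \in \omega_1^{\omega_1}$ satisfies $f \le^* g$ for some $g$ in the family). For $\mathcal{R} \subseteq [\omega_1]^{\aleph_1}$, a set $T \subseteq \omega_1$ splits $\mathcal{R}$ iff $|X \cap T| = |X \setminus T| = \aleph_1$ for all $X \in \mathcal{R}$. $\mathfrak{r}_{\omega_1}$ is the least cardinality of an $\mathcal{R} \subseteq [\omega_1]^{\aleph_1}$ such that no $T \subseteq \omega_1$ splits $\mathcal{R}$. *)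

(* Defs.v *)
From mathcomp Require Import all_boot all_order wochoice all_classical.

Set Implicit Arguments.
Unset Strict Implicit.
Unset Printing Implicit Defensive.

Import Order.TTheory.

Local Open Scope classical_set_scope.
Local Open Scope order_scope.
Local Open Scope card_scope.

(* As there is no type of cardinals in the library, the least cardinality of a
   member of P is represented by a member of P that has it, to be compared with
   other sets by #<= and #=.  The value set0 is only taken when P is empty: see
   least_cardP. *)
Definition least_card {T : Type} (P : set (set T)) : set T :=
  xget set0 [set A | P A /\ forall B, P B -> A #<= B].

Lemma least_cardP {T : Type} (P : set (set T)) : P !=set0 ->
  P (least_card P) /\ forall B, P B -> least_card P #<= B.
Proof.
move=> [A0 PA0].
suff: exists A, P A /\ forall B, P B -> A #<= B by move=> /(xgetPex set0).
(* A maximal set F of choice functions on P whose projections are injective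
   has a surjective projection. *)
pose Q (F : set (set T -> T)) := forall A, P A ->
  (forall s, F s -> A (s A)) /\
  (forall s t, F s -> F t -> s A = t A -> s = t).
have [F [QF maxF]] : exists F, Q F /\ forall G, F `<` G -> ~ Q G.
  apply: Zorn_bigcup => C CQ Ctot A PA; split=> [s [F CF Fs]|s t].
    exact: (CQ F CF A PA).1.
  move=> [F CF Fs] [G CG Gt].
  have [FG|GF] := Ctot F G CF CG.
    exact: (CQ G CG A PA).2 (FG _ Fs) Gt.
  exact: (CQ F CF A PA).2 Fs (GF _ Gt).
have [[A PA AF]|noA] :=
    pselect (exists2 A, P A & A `<=` [set s A | s in F]).
  exists A; split=> // B PB.
  apply: card_le_trans (subset_card_le AF) _.
  apply: card_le_trans (card_image_le _ _) _.
  have injB : {in F &, injective (fun s : set T -> T => s B)}.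
    by move=> s t /set_mem Fs /set_mem Ft; exact: (QF B PB).2.
  have := inj_card_eq injB; rewrite card_eq_sym => /card_eqPle[FB _].
  apply: card_le_trans FB _; apply: subset_card_le => _ [s Fs <-].
  exact: (QF B PB).1.
have ex A : P A -> exists x, A x /\ ~ [set s A | s in F] x.
  move=> PA; apply: contrapT => nex; apply: noA; exists A => // x Ax.
  by apply: contrapT => nFx; apply: nex; exists x.
have [x0 _] := ex A0 PA0.
pose s A := if pselect (P A) is left PA then projT1 (cid (ex A PA)) else x0.
have sP A : P A -> A (s A) /\ ~ [set s A | s in F] (s A).
  by rewrite /s; case: pselect => // PA _; exact: projT2 (cid (ex A PA)).
have nFs : ~ F s by move=> Fs; apply: (sP A0 PA0).2; exists s.
exfalso; apply: (maxF (s |` F)).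
  by split=> [t Ft|sub]; [right|apply: nFs; apply: sub; left].
move=> A PA; have [As nsA] := sP A PA.
split=> [t [->//|]|t u]; first exact: (QF A PA).1.
move=> [->|Ft] [->|Fu] // e.
- by case: nsA; exists u.
- by case: nsA; exists t.
- exact: (QF A PA).2 Ft Fu e.
Qed.

(* A model of the ordinal omega_1: a well-ordered set which is uncountable but
   all of whose proper initial segments are countable.  Its full set has
   cardinality aleph_1. *)
Definition is_omega1 (d : Order.disp_t) (W : orderType d) : Prop :=
  [/\ well_order (<=%O : rel W),
      ~ countable [set: W] &
      forall x : W, countable [set y : W | y < x]].

(* In this section W is meant to be omega_1. *)
Section SetAlgebras.
Variable W : Type.
Implicit Types B C E : set (set W).

Definition finite_cofinite : set (set W) :=
  [set b | finite_set b \/ cofinite_set b].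

Definition set_algebra B : Prop :=
  [/\ B set0, B setT, setU_closed B, setI_closed B &
      forall b, B b -> B (~` b)].

Definition subalgebra B C : Prop := set_algebra B /\ B `<=` C.

Definition proper_subalgebra B C : Prop := subalgebra B C /\ B <> C.

Definition dichotomous B : Prop :=
  [/\ subalgebra B setT, subalgebra finite_cofinite B &
      forall b, B b ->
        finite_cofinite b \/ (b #= [set: W] /\ ~` b #= [set: W])].

Definition sa B E : set (set W) := smallest (fun C => subalgebra C B) E.

Definition irredundant B E : Prop :=
  E `<=` B /\ forall a, E a -> ~ sa B (E `\ a) a.

Definition maximal_irredundant B E : Prop :=
  irredundant B E /\ forall E', irredundant B E' -> ~ (E `<` E').

Definition irr_mm B : set (set W) := least_card (maximal_irredundant B).

End SetAlgebras.

Arguments finite_cofinite W : clear implicits.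

Section CardinalCharacteristics.
Variables (d : Order.disp_t) (W : orderType d).

Definition le_star (f g : W -> W) : Prop := countable [set x | g x < f x].

Definition unbounded (F : set (W -> W)) : Prop :=
  ~ exists g, forall f, F f -> le_star f g.

Definition dominating (F : set (W -> W)) : Prop :=
  forall f, exists2 g, F g & le_star f g.

Definition splits (T : set W) (R : set (set W)) : Prop :=
  forall X, R X -> X `&` T #= [set: W] /\ X `\` T #= [set: W].

Definition unsplittable (R : set (set W)) : Prop :=
  (forall X, R X -> X #= [set: W]) /\ ~ exists T, splits T R.

Definition b_number : set (W -> W) := least_card unbounded.
Definition d_number : set (W -> W) := least_card dominating.
Definition r_number : set (set W) := least_card unsplittable.

End CardinalCharacteristics.

Arguments b_number {d} W.
Arguments d_number {d} W.
Arguments r_number {d} W.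

(* Main.v *)
(** Write b, d, r for the three cardinal invariants.  Choose a well-ordered
    index set [I] of size d whose proper initial segments have size < d, and
    functions [g i] (i in [I]) that dominate everywhere, not only up to
    countable sets.  [B] is generated over the finite-cofinite algebra by sets
    [b i], where [b i] splits every infinite element of the algebra generated
    before stage [i] and is saturated: it does not separate [x] from [y] when
    [x <= g i y] and [y <= g i x].  As this relation generates an equivalence
    with countable classes, there is a map [e] with countable fibres that is
    constant on them; some set splits all the images [e @` X], which are fewer
    than d <= r in number, and [b i] is its preimage under [e].

    Let [E] be irredundant in [B] with |[E]| < b.  The indices at which the
    elements of [E] are generated are bounded in [I].  Adding some later [b i]
    to [E] can destroy irredundance only through some [a] in [E] and a finite
    [F], cut by [b i], such that [F] and [a `\` F] are generated by [E `\ a].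
    If [F = F a] is chosen minimal, then each point lies in [F a] for only
    finitely many [a], so there is [h] with [y <= h x] whenever [x] and [y] lie
    in a common [F a].  Once [g i] dominates [h], [b i] cuts no [F a], and [E]
    is not maximal. *)
From Stdlib Require Import Wellfounded Relation_Operators.
Require Import Defs.
From mathcomp Require Import all_boot all_order wochoice finmap all_classical.

Set Implicit Arguments.
Unset Strict Implicit.
Unset Printing Implicit Defensive.

Import Order.TTheory.

Local Open Scope order_scope.
Local Open Scope classical_set_scope.
Local Open Scope card_scope.

(** * Well-orders and cardinal arithmetic *)

Definition some_of T (x0 : T) (P : set T) : T :=
  if pselect (P !=set0) is left e then projT1 (cid e) else x0.

Lemma some_ofP T (x0 : T) (P : set T) : P !=set0 -> P (some_of x0 P).
Proof. by rewrite /some_of; case: pselect => // e _; exact: projT2 (cid e). Qed.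

Lemma sub_image_card_le T U (f : T -> U) (A : set T) (B : set U) :
  B `<=` f @` A -> B #<= A.
Proof. by move=> /subset_card_le/card_le_trans; apply;
  exact: card_image_le. Qed.

Lemma inj_in_card_le T U (f : T -> U) (A : set T) (B : set U) :
  (forall x, A x -> B (f x)) ->
  (forall x y, A x -> A y -> f x = f y -> x = y) -> A #<= B.
Proof.
move=> fAB finj.
have injf : {in A &, injective f}.
  by move=> x y /set_mem Ax /set_mem Ay; exact: finj.
have := inj_card_eq injf; rewrite card_eq_sym => /card_eqPle[+ _].
move=> /card_le_trans; apply; apply: subset_card_le => _ [x Ax <-]; exact: fAB.
Qed.

Lemma card_le_inj_in T U (u0 : U) (A : set T) (B : set U) : A #<= B ->
  exists f : T -> U, (forall x, A x -> B (f x)) /\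
    (forall x y, A x -> A y -> f x = f y -> x = y).
Proof.
move=> /card_leP[f].
pose F x := if pselect (A x) is left Ax then set_val (f (SigSub (mem_set Ax)))
            else u0.
exists F; rewrite /F; split=> [x Ax|x y Ax Ay].
  case: pselect => // Ax'; exact: set_valP.
case: pselect => // Ax'; case: pselect => // Ay' /val_inj.
by move=> /(@inj _ _ _ f); rewrite !inE => /(_ Logic.I Logic.I) [].
Qed.

Lemma card_le_surj_in T U (t0 : T) (A : set T) (B : set U) : A #<= B ->
  exists f : U -> T, A `<=` f @` B.
Proof.
have [[u0 Bu0] AB|B0] := pselect (B !=set0); last first.
  by move/nonemptyPn: B0 => -> /card_le0P ->; exists (fun=> t0).
have [f [fAB finj]] := card_le_inj_in u0 AB.
exists (fun u => some_of t0 [set t | A t /\ f t = u]) => t At.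
exists (f t); first exact: fAB.
by have [] := @some_ofP _ t0 [set t' | A t' /\ f t' = f t];
  [exists t|move=> A' /finj ->].
Qed.

Lemma card_leX T T' U U' (A : set T) (A' : set T') (B : set U) (B' : set U') :
  A #<= A' -> B #<= B' -> A `*` B #<= A' `*` B'.
Proof.
move=> AA BB; have [[[a0 b0] [/= Aa0 Bb0]]|e] := pselect (A `*` B !=set0);
  last first.
  by move/nonemptyPn: e => ->; exact: card_ge0.
have [f fP] := card_le_surj_in a0 AA; have [g gP] := card_le_surj_in b0 BB.
apply: (@sub_image_card_le _ _ (fun p => (f p.1, g p.2))) => -[a b] [/= Aa Bb].
by have [x A'x <-] := fP _ Aa; have [y B'y <-] := gP _ Bb; exists (x, y).
Qed.

(* The value at [t] is constrained in terms of the set of earlier values. *)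
Lemma wf_choice_rec T (lt : T -> T -> Prop) U (u0 : U)
    (P : T -> set U -> set U) : well_founded lt ->
  exists f : T -> U, forall t,
    P t (f @` [set s | lt s t]) !=set0 -> P t (f @` [set s | lt s t]) (f t).
Proof.
move=> wf.
pose G t (rec : forall s, lt s t -> U) :=
  some_of u0 (P t [set u | exists s (h : lt s t), rec s h = u]).
exists (Fix wf (fun=> U) G) => t.
have -> : Fix wf (fun=> U) G t =
    some_of u0 (P t (Fix wf (fun=> U) G @` [set s | lt s t])).
  rewrite Fix_eq => [|x f g fg]; rewrite /G.
    congr (some_of _ (P t _)); apply/seteqP.
    by split=> u [s]; [move=> [h <-]; exists s|move=> h <-; exists s, h].
  congr (some_of _ (P x _)); apply/seteqP.
  by split=> u [s [h <-]]; exists s, h.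
exact: some_ofP.
Qed.

Definition total_lt T (lt : T -> T -> Prop) :=
  forall x y, x <> y -> lt x y \/ lt y x.

Lemma card_le_segment_or T (lt : T -> T -> Prop) U (X : set U) :
  well_founded lt -> total_lt lt ->
  (exists t, X #<= [set s | lt s t]) \/ [set: T] #<= X.
Proof.
move=> wf tot; have [?|noseg] := pselect (exists t, X #<= [set s | lt s t]).
  by left.
right; have [t0|T0] := pselect (exists t : T, True); last first.
  rewrite (_ : setT = set0) ?card_ge0//.
  by apply/seteqP; split => // x _; case: T0; exists x.
have [u0 _] : X !=set0.
  have [t _] := t0; apply: contrapT => /nonemptyPn X0.
  by apply: noseg; exists t; rewrite X0 card_ge0.
have [f fP] := wf_choice_rec u0 (fun _ A => X `\` A) wf.
have {}fP t : (X `\` f @` [set s | lt s t]) (f t).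
  apply: fP; apply: contrapT => e; apply: noseg; exists t.
  apply: (@sub_image_card_le _ _ f) => u Xu.
  by apply: contrapT => nu; apply: e; exists u.
apply: (@inj_in_card_le _ _ f) => [t _|s t _ _ fst]; first by have [] := fP t.
apply: contrapT => /tot [st|ts].
  by have [_] := fP t; apply; exists s.
by have [_] := fP s; apply; exists t.
Qed.

Lemma well_order_wf (T : eqType) (R : rel T) : well_order R ->
  well_founded (fun x y => R x y && (x != y)) /\
  total_lt (fun x y => R x y && (x != y)).
Proof.
move=> wo; have wo' : wo_chain R predT by move=> A _; exact: wo.
have anti x y : R x y && R y x -> x = y by exact: (wo_chain_antisymmetric wo').
split.
- move=> x; apply: contrapT => nx.
  have [|z [[/asboolP nz zmin] _]] :=
      wo [pred y | `[< ~ Acc (fun x y => R x y && (x != y)) y >]].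
    by exists x; apply/asboolP.
  apply: nz; constructor => y /andP[yz neq]; apply: contrapT => ny.
  have zy : R z y by apply: zmin; apply/asboolP.
  by move/eqP: neq; apply; apply: anti; rewrite yz zy.
- move=> x y /eqP xy; have [|z [[/=]]] := wo [pred z | (z == x) || (z == y)].
    by exists x; rewrite inE eqxx.
  rewrite inE => /orP[]/eqP -> zmin _; [left|right];
    rewrite 1?[y == x]eq_sym xy andbT.
    by apply: zmin; rewrite inE eqxx orbT.
  by apply: zmin; rewrite inE eqxx.
Qed.

Lemma exists_well_order T : exists lt : T -> T -> Prop,
  well_founded lt /\ total_lt lt.
Proof.
have [R /well_order_wf[wf tot]] := well_ordering_principle {classic T}.
by exists (fun x y : {classic T} => R x y && (x != y)).
Qed.

Lemma wf_asym T (lt : T -> T -> Prop) x y :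
  well_founded lt -> lt x y -> ~ lt y x.
Proof.
move=> wf; elim: x / (wf x) y => x _ IH y xy yx; exact: (IH y yx x yx xy).
Qed.

(** By totality a failure would close a cycle, which well-foundedness excludes. *)
Lemma wf_total_trans T (lt : T -> T -> Prop) x y z :
  well_founded lt -> total_lt lt -> lt x y -> lt y z -> lt x z.
Proof.
move=> wf tot xy yz; apply: contrapT => nxz.
have xz : x <> z by move=> xz; rewrite xz in xy; exact: wf_asym xy yz.
have zx : lt z x by case: (tot _ _ xz).
elim: x / (wf x) y z xy yz {nxz xz} zx => x _ IH y z xy yz zx.
exact: (IH z zx x y zx xy yz).
Qed.

(** If some segment has full size, take the least such one: pulling [lt] back along an injection of
    [T] into it leaves only smaller segments. *)
Lemma exists_initial_well_order T : exists lt : T -> T -> Prop,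
  [/\ well_founded lt, total_lt lt &
      forall t, ~ ([set: T] #<= [set s | lt s t])].
Proof.
have [lt [wf tot]] := exists_well_order T.
have [[t0 t0P]|no] := pselect (exists t, [set: T] #<= [set s | lt s t]);
  last first.
  by exists lt; split => // t tP; apply: no; exists t.
have [t [tP tmin]] : exists t, [set: T] #<= [set s | lt s t] /\
    forall s, lt s t -> ~ ([set: T] #<= [set r | lt r s]).
  apply: contrapT => no; elim: t0 / (wf t0) t0P => t _ IH tP; apply: no.
  by exists t; split => // s st sP; exact: IH st sP.
have [f [fl finj]] := card_le_inj_in t tP.
exists (fun x y => lt (f x) (f y)); split.
- exact: (wf_inverse_image _ _ lt f wf).
- by move=> x y xy; apply: tot => /finj e; apply: xy; exact: e.
- move=> s sP; apply: (tmin (f s)); first exact: fl.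
  apply: card_le_trans sP _; apply: (@inj_in_card_le _ _ f) => // x y _ _.
  exact: finj.
Qed.

Lemma card_le_total T U (A : set T) (B : set U) : A #<= B \/ B #<= A.
Proof.
have [lt [wf tot]] := exists_well_order A.
have /card_eqPle[AT TA] := card_setT A.
have [[t Bt]|AB] := card_le_segment_or B wf tot.
  right; apply: card_le_trans Bt _; apply: card_le_trans AT.
  exact: subset_card_le.
by left; exact: card_le_trans TA AB.
Qed.

(** Hilbert's hotel along an injective sequence [f] in [A]: [x] moves to [f 0] and [f n] to
    [f n.+1]. *)
Lemma infinite_setU1_card_le T (A : set T) (x : T) :
  infinite_set A -> x |` A #<= A.
Proof.
move=> /infiniteP /(card_le_inj_in x)[f [fA finj]].
have finj' m n : f m = f n -> m = n by exact: finj.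
pose F y := if pselect (y = x) is left _ then f 0%N else
  if pselect (exists n, f n = y) is left e then f (projT1 (cid e)).+1 else y.
apply: (@inj_in_card_le _ _ F) => [y [->|Ay]|y z _ _].
- by rewrite /F; case: pselect => // _; exact: fA.
- by rewrite /F; case: pselect => _; [exact: fA|case: pselect => // e;
    exact: fA].
rewrite /F; case: (pselect (y = x)) => [->|_];
  case: (pselect (z = x)) => [->|_] //.
- by case: pselect => [e /finj'//|ne e]; case: ne; exists 0%N.
- by case: pselect => [e /finj'//|ne e]; case: ne; exists 0%N.
case: pselect => [e|ne]; case: pselect => [e'|ne'] //.
- by case: (cid e) => m em; case: (cid e') => n en /= /finj' [mn];
    rewrite -em -en mn.
- by move=> ez; case: ne'; eexists; exact: ez.
- by move=> ey; case: ne; eexists; symmetry; exact: ey.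
Qed.

(* Goedel's ordering of pairs, by maximum first. *)
Lemma card_le_square_of_segments T (lt : T -> T -> Prop) (S : set T) :
  well_founded lt -> total_lt lt ->
  (forall x y, S y -> lt x y -> S x) ->
  (forall m, S m -> infinite_set [set s | lt s m] ->
    [set s | lt s m] `*` [set s | lt s m] #<= [set s | lt s m]) ->
  infinite_set S -> S `*` S #<= S.
Proof.
move=> wf tot down IH infS.
pose max x y := if pselect (lt x y) then y else x.
have max_l x y : x = max x y \/ lt x (max x y).
  by rewrite /max; case: pselect; [right|left].
have max_r x y : y = max x y \/ lt y (max x y).
  rewrite /max; case: pselect => [xy|nxy] /=; first by left.
  by have [->|/tot[//|]] := pselect (x = y); [left|right].
pose key (p : S `*` S) :=
  (max (val p).1 (val p).2, ((val p).1, (val p).2)).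
pose ltp p q := slexprod _ _ lt (slexprod _ _ lt lt) (key p) (key q).
have wfp : well_founded ltp.
  have wf2 := wf_slexprod _ _ _ _ wf wf.
  exact: (wf_inverse_image _ _ _ key (wf_slexprod _ _ _ _ wf wf2)).
have totp : total_lt ltp.
  move=> p q pq; rewrite /ltp /key.
  have [->|/tot[|]] :=
      pselect (max (val p).1 (val p).2 = max (val q).1 (val q).2);
    [|by left; left|by right; left].
  have [e1|/tot[|]] := pselect ((val p).1 = (val q).1);
    [|by left; right; left|by right; right; left].
  have [e2|/tot[|]] := pselect ((val p).2 = (val q).2);
    [|by left; right; rewrite e1; right|by right; right; rewrite e1; right].
  by case: pq; apply: val_inj; apply: injective_projections.
have /card_eqPle[_ SS] := card_setT (S `*` S).
(* Otherwise [S] embeds in the pairs before some [p], hence in the square of the points up to [m];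
   the segment below [m] then has the size of [S], and [IH] applies to it. *)
have [[p]|] := card_le_segment_or S wfp totp; last exact: card_le_trans SS.
set m := max (val p).1 (val p).2.
have Sm : S m.
  have [/= S1 S2] : (S `*` S) (val p) by exact: set_valP.
  by rewrite /m /max; case: pselect.
have le_mm : [set q | ltp q p] #<=
    (m |` [set s | lt s m]) `*` (m |` [set s | lt s m]).
  apply: (@inj_in_card_le _ _ val) => [q /=|q r _ _]; last exact: val_inj.
  rewrite /ltp /key -/m => qp.
  have : max (val q).1 (val q).2 = m \/ lt (max (val q).1 (val q).2) m.
    by inversion qp; [right|left].
  have := max_l (val q).1 (val q).2; have := max_r (val q).1 (val q).2.
  move: (max _ _) => k e2 e1 ek.
  have aux y : y = k \/ lt y k -> y = m \/ lt y m.
    move=> [->//|yk]; case: ek => [<-|km]; first by right.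
    by right; exact: wf_total_trans yk km.
  by split; exact: aux.
move=> /card_le_trans/(_ le_mm) Smm.
have infm : infinite_set [set s | lt s m].
  move=> fin; apply: infS; apply: card_le_finite Smm _.
  by apply: finite_setX; rewrite finite_setU; split.
have mS : [set s | lt s m] #<= S.
  by apply: subset_card_le => s; exact: down.
have Sm' : S #<= [set s | lt s m].
  apply: card_le_trans (IH _ Sm infm); apply: card_le_trans Smm _.
  by apply: card_leX; exact: infinite_setU1_card_le.
by apply: card_le_trans mS; apply: card_le_trans (IH _ Sm infm);
  exact: card_leX.
Qed.

Lemma card_le_square T (A : set T) : infinite_set A -> A `*` A #<= A.
Proof.
move=> infA; have [lt [wf tot]] := exists_well_order A.
have seg m : infinite_set [set s | lt s m] ->
    [set s | lt s m] `*` [set s | lt s m] #<= [set s | lt s m].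
  elim: m / (wf m) => m _ IH; apply: (@card_le_square_of_segments _ lt) => //.
  by move=> x y /= ym xy; exact: wf_total_trans xy ym.
have /card_eqPle[TA AT] := card_setT A.
apply: card_le_trans TA; apply: card_le_trans (card_leX AT AT) _.
apply: (@card_le_square_of_segments _ lt) => // [m _|finT]; first exact: seg.
by apply: infA; exact: card_le_finite AT finT.
Qed.

Lemma infinite_card_leU T U (K : set U) (A B : set T) : infinite_set K ->
  A #<= K -> B #<= K -> A `|` B #<= K.
Proof.
move=> infK AK BK; have [[t0 _]|AB0] := pselect (A `|` B !=set0); last first.
  by move/nonemptyPn: AB0 => ->; exact: card_ge0.
have [f fP] := card_le_surj_in t0 AK; have [g gP] := card_le_surj_in t0 BK.
apply: card_le_trans (card_le_square infK).
apply: (@card_le_trans _ _ _ ([set: bool] `*` K)).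
  apply: (@sub_image_card_le _ _ (fun p => if p.1 then f p.2 else g p.2)).
  by move=> t [/fP[u Ku <-]|/gP[u Ku <-]]; [exists (true, u)|exists (false, u)].
apply: card_leX => //; apply: card_le_trans ((infiniteP _).1 infK).
exact: finite_set_countable.
Qed.

(** * Countable sets and splitting on omega_1 *)

Lemma countableU T (A B : set T) : countable A -> countable B -> countable (A
  `|` B).
Proof.
move=> cA cB; rewrite (_ : A `|` B = \bigcup_(b in [set: bool]) (if b then A
  else B)).
  by apply: bigcup_countable => [|[]].
by apply/seteqP; split => [x [Ax|Bx]|x [[] _ ?]];
  [exists true|exists false|left|right].
Qed.

Section Omega1.
Variables (d : Order.disp_t) (W : orderType d).
Hypothesis omega1 : is_omega1 W.
Implicit Types (X : set W) (g : W -> W).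

Lemma omega1_wf : well_founded (fun x y : W => x < y).
Proof.
have [/well_order_wf[wf _] _ _] := omega1; move=> x.
elim: x / (wf x) => x _ IH; constructor => y.
by rewrite lt_neqAle => /andP[neq yx]; apply: IH; rewrite yx.
Qed.

Lemma omega1_total : total_lt (fun x y : W => x < y).
Proof. by move=> x y /eqP; rewrite neq_lt => /orP. Qed.

(** An uncountable set does not embed in a countable segment, so comparison leaves only full
    size. *)
Lemma omega1_uncountableP X : X #= [set: W] <-> ~ countable X.
Proof.
have [_ uncW segW] := omega1; split.
  by move=> /card_eqPle[_ WX] cX; apply: uncW; exact: card_le_trans WX cX.
move=> uncX; apply/card_eqPle; split; first exact: card_leT.
have [[t Xt]|//] := card_le_segment_or X omega1_wf omega1_total.
by case: uncX; exact: card_le_trans Xt (segW t).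
Qed.

Lemma omega1_countable_le x : countable [set y : W | y <= x].
Proof.
have [_ _ segW] := omega1.
apply: (@sub_countable _ _ _ ([set y | y < x] `|` [set x])).
  apply: subset_card_le => y /=; rewrite le_eqVlt.
  by move=> /orP[/eqP->|]; [right|left].
by apply: countableU.
Qed.

Lemma omega1_bounded X : countable X -> exists u, forall x, X x -> x < u.
Proof.
have [_ uncW _] := omega1 => cX.
have cU : countable (\bigcup_(x in X) [set y | y <= x]).
  by apply: bigcup_countable => // x _; exact: omega1_countable_le.
apply: contrapT => nex; apply: uncW; apply: sub_countable cU.
apply: subset_card_le => u _; apply: contrapT => nu; apply: nex.
exists u => x Xx; rewrite ltNge; apply/negP => ux.
by apply: nu; exists x.
Qed.

Lemma omega1_inhabited : exists w : W, True.
Proof.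
by have [|u _] := @omega1_bounded set0; [exact: countable0|exists u].
Qed.

Lemma omega1_infinite : infinite_set [set: W].
Proof.
by have [_ + _] := omega1; apply: contra_not; exact: finite_set_countable.
Qed.

(* Diagonalization: [f x] exceeds [F w x] for all [w <= x]. *)
Lemma not_dominating_range (F : W -> W -> W) : ~ dominating (range F).
Proof.
have [_ uncW _] := omega1 => domF.
have bd x : exists u, forall y, [set F w x | w in [set w | w <= x]] y -> y < u.
  apply: omega1_bounded.
  exact: card_le_trans (card_image_le _ _) (omega1_countable_le x).
have [f fP] := choice bd.
have [_ [w _ <-] fFw] := domF f.
apply: uncW; apply: sub_countable (countableU fFw (omega1_countable_le w)).
apply: subset_card_le => x _ /=; have [wx|/ltW xw] := leP w x; [left|by right].
by apply: fP; exists w.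
Qed.

Lemma d_numberP : dominating (d_number W) /\
  forall F : set (W -> W), dominating F -> d_number W #<= F.
Proof.
apply: least_cardP; exists setT => f; exists f => //.
rewrite /le_star (_ : [set x | _] = set0) ?countable0//.
by apply/seteqP; split => // x /=; rewrite ltxx.
Qed.

Lemma d_number_gt : ~ (d_number W #<= [set: W]).
Proof.
move=> /(card_le_surj_in id)[F DF]; apply: (@not_dominating_range F).
by move=> f; have [g /DF[w _ <-] fg] := d_numberP.1 f; exists (F w);
  [exists w|].
Qed.

(* [e x] represents the closure of [x] under passing from [y] to the points
   below [g y]. *)
Lemma exists_collapse g : exists e : W -> W,
  (forall x y, x <= g y -> y <= g x -> e x = e y) /\
  (forall x, countable [set y | e y = e x]).
Proof.
pose S x n := iter n (fun A => \bigcup_(z in A) [set y | y <= g z]) [set x].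
pose C x := \bigcup_n S x n.
have cC x : countable (C x).
  apply: bigcup_countable => // n _; rewrite /S.
  elim: n => [|n IH] /=; first exact: countable1.
  by apply: bigcup_countable => // z _; exact: omega1_countable_le.
have Cstep x y z : C x y -> z <= g y -> C x z.
  by move=> [n _ Sy] zy; exists n.+1 => //; exists y.
have Cxx x : C x x by exists 0%N.
have Csub x y : C x y -> C y `<=` C x.
  move=> Cxy z [n _]; elim: n z => [z ->//|n IH z [w Sw zw]].
  exact: Cstep (IH _ Sw) zw.
have [w0 _] := omega1_inhabited.
exists (fun x => some_of w0 [set y | C y = C x]); split=> [x y xy yx|x].
  suff -> : C x = C y by [].
  apply/seteqP; split; apply: Csub.
    exact: Cstep xy.
  exact: Cstep yx.
(* Every point lies in its own closure, so the fibre through [x] lies in [C x]. *)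
apply: sub_countable (cC x); apply: subset_card_le => y /= exy.
have P z : C (some_of w0 [set y | C y = C z]) = C z.
  by apply: (@some_ofP _ _ [set y | C y = C z]); exists z.
by rewrite -(P x) -exy P.
Qed.

(** As [e] has countable fibres, the images under [e] of the members of [K] stay uncountable, and
    they are too few to be unsplittable. The preimage of a splitting set is a union of fibres, hence
    saturated. *)
Lemma exists_splitting_saturated (K : set (set W)) g :
  (forall X, K X -> ~ countable X) -> ~ (r_number W #<= K) ->
  exists b : set W, (forall x y, x <= g y -> y <= g x -> b x -> b y) /\
    forall X, K X -> ~ countable (X `&` b) /\ ~ countable (X `\` b).
Proof.
move=> uncK rK; have [e [eg ce]] := exists_collapse g.
have unc_image X : countable (e @` X) -> countable X.
  move=> cX.
  apply: (@sub_countable _ _ _ (\bigcup_(z in e @` X) [set y | e y = z])).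
    by apply: subset_card_le => x Xx; exists (e x) => //; exists x.
  by apply: bigcup_countable => // _ [x _ <-]; exact: ce.
pose R := [set e @` X | X in K].
have RK : R #<= K by exact: card_image_le.
have uncR Y : R Y -> Y #= [set: W].
  move=> [X KX <-]; apply/omega1_uncountableP => /unc_image; exact: uncK.
have : ~ unsplittable R.
  move=> uR; apply: rK; apply: card_le_trans RK.
  by apply: (least_cardP _).2 => //; exists R.
move=> nu; have [T TR] : exists T, splits T R.
  by apply: contrapT => nT; apply: nu.
exists (e @^-1` T); split=> [x y xy yx|X KX].
  by rewrite /preimage /= (eg x y).
have [/omega1_uncountableP u1 /omega1_uncountableP u2] :
    e @` X `&` T #= [set: W] /\ e @` X `\` T #= [set: W].
  by apply: TR; exists X.
split; [apply: contra_not u1|apply: contra_not u2] => cX.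
  apply: (@sub_countable _ _ _ (e @` (X `&` e @^-1` T))).
    by apply: subset_card_le => _ [[x Xx <-] Tx]; exists x.
  by apply: card_le_trans (card_image_le _ _) cX.
apply: (@sub_countable _ _ _ (e @` (X `\` e @^-1` T))).
  by apply: subset_card_le => _ [[x Xx <-] Tx]; exists x.
by apply: card_le_trans (card_image_le _ _) cX.
Qed.

End Omega1.

(** * Generated subalgebras *)

Section Algebra.
Variable W : Type.
Implicit Types (B C E : set (set W)) (a b c p : set W).

Lemma set_algebra_setC C b : set_algebra C -> C b -> C (~` b).
Proof. by case=> _ _ _ _; apply. Qed.

Lemma set_algebra_setI C b c : set_algebra C -> C b -> C c -> C (b `&` c).
Proof. by case=> _ _ _ CI _; exact: CI. Qed.

Lemma set_algebra_setU C b c : set_algebra C -> C b -> C c -> C (b `|` c).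
Proof. by case=> _ _ CU _ _; exact: CU. Qed.

Lemma set_algebra_setD C b c : set_algebra C -> C b -> C c -> C (b `\` c).
Proof.
by move=> alg Cb Cc; rewrite setDE; apply: set_algebra_setI => //;
  exact: set_algebra_setC.
Qed.

Lemma set_algebraDI C : C set0 -> C setT ->
  (forall b c, C b -> C c -> C (b `\` c)) -> set_algebra C.
Proof.
move=> C0 CT CD; have CC b : C b -> C (~` b) by rewrite -setTD; exact: CD.
have CI : setI_closed C by move=> b c Cb Cc; rewrite -[c]setCK -setDE; auto.
split=> // b c Cb Cc; rewrite -[b `|` c]setCK setCU; auto.
Qed.

Lemma set_algebra_sa B E : set_algebra B -> E `<=` B -> set_algebra (sa B E).
Proof.
move=> algB EB.
apply: set_algebraDI => [C [[[]]]//|C [[[]]]//|b c sb sc C [algC EC]].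
by apply: set_algebra_setD; [exact: algC.1|apply: sb|apply: sc].
Qed.

Lemma sa_sub B E : set_algebra B -> E `<=` B -> sa B E `<=` B.
Proof. by move=> algB EB; apply: smallest_sub => //; split. Qed.

Lemma sub_sa B E : E `<=` sa B E.
Proof. exact: sub_gen_smallest. Qed.

Lemma saS B E E' : E `<=` E' -> sa B E `<=` sa B E'.
Proof.
move=> EE' p sp C [subC E'C]; apply: sp; split=> //; exact: subset_trans E'C.
Qed.

Lemma sa_min B C E : set_algebra C -> E `<=` C -> C `<=` B -> sa B E `<=` C.
Proof. by move=> algC EC CB; apply: smallest_sub. Qed.

(** Frees generated algebras from the ambient [B]: [sa setT E] already lies in [B]. *)
Lemma sa_saT B E : set_algebra B -> E `<=` B -> sa B E = sa setT E.
Proof.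
move=> algB EB; apply/seteqP; split.
  apply: sa_min; [exact: set_algebra_sa|exact: sub_sa|].
  exact: sa_min.
by apply: sa_min => //; [exact: set_algebra_sa|exact: sub_sa].
Qed.

(** For an algebra [C], the algebra generated by [C] and [b], in normal form: an element of [C] is
    prescribed on [b] and another one off [b]. *)
Definition adjoin C b : set (set W) :=
  [set p | exists c e, [/\ C c, C e & p = (c `&` b) `|` (e `\` b)]].

Lemma sub_adjoin C b : C `<=` adjoin C b.
Proof.
move=> c Cc; exists c, c; split=> //; apply/seteqP.
by split=> x /=; have [] := pselect (b x); tauto.
Qed.

Lemma adjoin_self C b : set_algebra C -> adjoin C b b.
Proof.
by case=> C0 CT _ _ _; exists setT, set0; split=> //; rewrite setTI set0D setU0.
Qed.

Lemma set_algebra_adjoin C b : set_algebra C -> set_algebra (adjoin C b).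
Proof.
move=> algC; have [C0 CT _ _ _] := algC; apply: set_algebraDI.
- exact: sub_adjoin.
- exact: sub_adjoin.
move=> _ _ [c [e [Cc Ce ->]]] [c' [e' [Cc' Ce' ->]]].
exists (c `\` c'), (e `\` e'); split; [exact: set_algebra_setD..|].
apply/seteqP; split=> x /=; have [] := pselect (b x); tauto.
Qed.

Lemma sa_setU1_sub B E b : set_algebra B -> E `<=` B -> B b ->
  sa B (b |` E) `<=` adjoin (sa B E) b.
Proof.
move=> algB EB Bb; have algE := set_algebra_sa algB EB.
apply: sa_min.
- exact: set_algebra_adjoin.
- by move=> p [->|Ep]; [exact: adjoin_self|apply: sub_adjoin; exact: sub_sa].
move=> _ [c [e [/(sa_sub algB EB) Cc /(sa_sub algB EB) Ce ->]]].
by apply: set_algebra_setU => //;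
  [apply: set_algebra_setI|apply: set_algebra_setD].
Qed.

Lemma sa_finite_support B E : set_algebra B -> E `<=` B -> forall p, sa B E p ->
  exists F, [/\ finite_set F, F `<=` E & sa B F p].
Proof.
move=> algB EB.
suff : sa B E `<=` [set q | exists F, [/\ finite_set F, F `<=` E & sa B F q]]
  by apply.
apply: sa_min.
- have [sa0 saT _ _ _] := set_algebra_sa algB (@sub0set _ B).
  apply: set_algebraDI.
  + by exists set0; split.
  + by exists set0; split.
  move=> p q [F [finF FE sp]] [G [finG GE sq]].
  have FGE : F `|` G `<=` E by rewrite subUset.
  exists (F `|` G); split=> //; first by rewrite finite_setU.
  apply: (@set_algebra_setD (sa B (F `|` G))).
  + by apply: set_algebra_sa => //; exact: subset_trans EB.
  + by apply: saS sp; exact: subsetUl.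
  + by apply: saS sq; exact: subsetUr.
- move=> p Ep; exists [set p]; split=> //; first by move=> _ ->.
  exact: sub_sa.
- move=> p [F [_ FE]]; apply: sa_sub => //; exact: subset_trans EB.
Qed.

Lemma set_algebra_finite_cofinite : set_algebra (finite_cofinite W).
Proof.
apply: set_algebraDI; [by left|by right; rewrite setCT|].
move=> b c [fb|cb]; first by left; exact: finite_setD.
move=> [fc|cc]; [right|left].
  by rewrite setDE setCI setCK finite_setU.
by apply: sub_finite_set cc => x [].
Qed.

Lemma sa_card_le U (K : set U) (E : set (set W)) :
  infinite_set K -> E #<= K -> sa setT E #<= K.
Proof.
move=> infK EK.
have E'K : set0 |` (setT |` E) #<= K.
  have [finE|infE] := pselect (finite_set E).
    apply: card_le_trans ((infiniteP _).1 infK).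
    by apply: finite_set_countable; rewrite !finite_setU.
  apply: card_le_trans EK; apply: (@card_le_trans _ _ _ (setT |` E)).
    by apply: infinite_setU1_card_le; apply: sub_infinite_set infE;
      exact: subsetUr.
  exact: infinite_setU1_card_le.
have [f0 f0P] := card_le_surj_in set0 E'K.
have [u0 _] := infinite_setN0 infK.
have [pi piP] := card_le_surj_in (u0, u0) (card_le_square infK).
(* The values of [f n] on [K] include all sets obtained from [set0], [setT] and [E] by [n] rounds of
   differences; [pi] decodes an index into a pair. *)
pose f := fix f n := if n is m.+1 then fun u => f m (pi u).1 `\` f m (pi u).2
  else f0.
pose C := \bigcup_n (f n @` K).
have fD n b c : (f n @` K) b -> (f n @` K) c -> (f n.+1 @` K) (b `\` c).
  move=> [u Ku <-] [v Kv <-]; have [|w Kw e] := piP (u, v); first by [].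
  by exists w => //=; rewrite e.
have f0n n : (f n @` K) set0.
  elim: n => [|n IH]; first by apply: f0P; left.
  by rewrite -[set0](setDv set0); exact: fD.
have fS n b : (f n @` K) b -> (f n.+1 @` K) b.
  by move=> fb; rewrite -[b]setD0; exact: fD.
have fle m n : (m <= n)%N -> f m @` K `<=` f n @` K.
  move=> /subnK <-; elim: (n - m)%N => [|k IH] // b /IH/fS; by rewrite addSn.
apply: (@card_le_trans _ _ _ ([set: nat] `*` K)).
  apply: (@sub_image_card_le _ _ (fun nu => f nu.1 nu.2)).
  suff : sa setT E `<=` C.
    by move=> + p Ep => /(_ p Ep)[n _ [u Ku <-]]; exists (n, u).
  apply: sa_min => //; last first.
    by move=> p Ep; exists 0%N => //; apply: f0P; right; right.
  apply: set_algebraDI.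
  - by exists 0%N => //; apply: f0P; left.
  - by exists 0%N => //; apply: f0P; right; left.
  - move=> b c [m _ fb] [n _ fc]; exists (maxn m n).+1 => //.
    by apply: fD; [apply: fle fb; exact: leq_maxl|apply: fle fc;
      exact: leq_maxr].
apply: card_le_trans (card_le_square infK).
by apply: card_leX => //; apply/infiniteP.
Qed.

End Algebra.

(** * Irredundant sets *)

Lemma finite_minimal (T : choiceType) (Q : set (set T)) (F : set T) :
  finite_set F -> Q F ->
  exists F', [/\ F' `<=` F, Q F' & forall G, Q G -> G `<=` F' -> G = F'].
Proof.
move: {2}(_.+1) (ltnSn #|` fset_set F|) => n.
elim: n F => // n IH F cF finF QF.
have [[G [QG GF nGF]]|no] :=
    pselect (exists G, [/\ Q G, G `<=` F & G <> F]); last first.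
  exists F; split=> // G QG GF; apply: contrapT => nGF; apply: no; by exists G.
have finG := sub_finite_set GF finF.
have [|F' [F'G QF' F'min]] := IH G _ finG QG; last first.
  by exists F'; split=> //; exact: subset_trans GF.
rewrite ltnS in cF; apply: leq_trans cF; apply: fproper_ltn_card.
have GF' : (fset_set G `<=` fset_set F)%fset by rewrite -fset_set_sub.
rewrite fproperEneq GF' andbT.
by apply/eqP => /fset_set_inj e; apply: nGF; exact: e.
Qed.

Section Irredundant.
Variable W : choiceType.
Implicit Types (B C E : set (set W)) (a b c p F : set W).

(** Zorn's lemma applies because a dependence in the union of a chain occurs in one of its members.
    Hence [irr_mm B] is not the default value of [least_card]. *)
Lemma exists_maximal_irredundant B : set_algebra B ->
  exists E, maximal_irredundant B E.
Proof.
move=> algB.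
suff [E [irrE maxE]] : exists E, irredundant B E /\
    forall E', E `<` E' -> ~ irredundant B E'.
  by exists E; split=> // E' irrE' /maxE.
apply: Zorn_bigcup => H Hirr Htot.
have HB : \bigcup_(E in H) E `<=` B by move=> b [E /Hirr[EB _] /EB].
split=> // a [E HE Ea] sa_a.
pose S := \bigcup_(G in H) sa B (G `\ a).
have algS : set_algebra S.
  have subS G : H G -> sa B (G `\ a) `<=` S by move=> HG p sp; exists G.
  have algG G : H G -> set_algebra (sa B (G `\ a)).
    move=> HG; apply: set_algebra_sa => // p [Gp _]; exact: (Hirr _ HG).1.
  have [S0 ST _ _ _] := algG _ HE.
  apply: set_algebraDI => [||p q [F HF sp] [G HG sq]];
    [exact: subS S0|exact: subS ST|].
  have [FG|GF] := Htot F G HF HG.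
    by exists G => //; apply: set_algebra_setD (algG _ HG) _ sq;
      apply: saS sp; exact: setSD.
  by exists F => //; apply: set_algebra_setD (algG _ HF) sp _; apply: saS sq;
    exact: setSD.
have [G HG sGa] : S a.
  apply: sa_min sa_a => // [p [[G HG Gp] npa]|p [G HG]].
    by exists G => //; apply: sub_sa.
  apply: sa_sub => // q [Gq _]; exact: (Hirr _ HG).1.
have [EG|GE] := Htot E G HE HG.
  by apply: (Hirr _ HG).2 sGa; exact: EG.
by apply: (Hirr _ HE).2 Ea _; apply: saS sGa; exact: setSD.
Qed.

(** All that [a] adds to [E] is confined to [F]: once the trace of [a] on [F] is generated by the
    rest of [E], so is [a]. *)
Definition critical B E a F :=
  [/\ finite_set F, sa B (E `\ a) F & sa B (E `\ a) (a `\` F)].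

(** If [b] were generated by [E], it would have to split itself or its complement. If [b] makes some
    [a] redundant, [a] has the normal form of [adjoin], which yields a critical set; one not cut by
    [b] shows that [a] was redundant before. *)
Lemma irredundant_setU1 B E b : infinite_set [set: W] -> set_algebra B ->
  irredundant B E -> B b ->
  (forall X, sa B E X -> infinite_set X -> X `&` b !=set0 /\ X `\` b !=set0) ->
  (forall a F, E a -> critical B E a F -> exists2 F', critical B E a F' &
     F' `<=` b \/ F' `&` b = set0) ->
  irredundant B (b |` E).
Proof.
move=> infW algB [EB irr] Bb split_b cut_b.
split=> [p [->//|]|a]; first exact: EB.
have subE a' : E `\ a' `<=` B by apply: subset_trans EB; exact: subDsetl.
have [-> _ sb|nab [//|Ea] sEa] := pselect (a = b).
  have {}sb : sa B E b by apply: saS sb => p [[]].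
  have algE := set_algebra_sa algB EB.
  have [finb|infb] := pselect (finite_set b); last first.
    by have [_ [x []]] := split_b _ sb infb.
  have infCb : infinite_set (~` b).
    by move=> finCb; apply: infW; rewrite -(setUv b) finite_setU.
  by have [[x []]] := split_b _ (set_algebra_setC algE sb) infCb.
have [c [e [sc se ea]]] : adjoin (sa B (E `\ a)) b a.
  apply: (sa_setU1_sub algB (subE a) Bb).
  apply: saS sEa => p [[->|Ep] npa]; [by left|by right].
have algEa := set_algebra_sa algB (subE a).
have subEa : sa B (E `\ a) `<=` sa B E by apply: saS; exact: subDsetl.
have algE := set_algebra_sa algB EB.
have saE : sa B E a by exact: sub_sa.
have ae x : a x <-> (b x /\ c x) \/ (~ b x /\ e x).
  by rewrite ea /=; tauto.
(* [b] does not split the symmetric differences of [a] with [c] and [e], so they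
   are finite; hence so is that of [c] with [e], outside of which [a] agrees
   with [c `&` e]. *)
have acb : (a `\` c `|` c `\` a) `&` b = set0.
  by apply/seteqP; split=> // x [/= h bx]; have := ae x; tauto.
have aeb : (a `\` e `|` e `\` a) `\` b = set0.
  by apply/seteqP; split=> // x [/= h bx]; have := ae x; tauto.
have finac : finite_set (a `\` c `|` c `\` a).
  apply: contrapT => inf; have [] := split_b (a `\` c `|` c `\` a) _ inf.
    by apply: (set_algebra_setU algE); apply: (set_algebra_setD algE); auto.
  by rewrite acb => -[].
have finae : finite_set (a `\` e `|` e `\` a).
  apply: contrapT => inf; have [] := split_b (a `\` e `|` e `\` a) _ inf.
    by apply: (set_algebra_setU algE); apply: (set_algebra_setD algE); auto.
  by rewrite aeb => _ [].
pose F := c `\` e `|` e `\` c.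
have finF : finite_set F.
  apply: (@sub_finite_set _ _ ((a `\` c `|` c `\` a) `|`
      (a `\` e `|` e `\` a))).
    by move=> x; rewrite /F /=; have [] := pselect (a x); tauto.
  by rewrite finite_setU.
have crit : critical B E a F.
  split=> //; first by apply: (set_algebra_setU algEa);
    exact: (set_algebra_setD algEa).
  rewrite (_ : a `\` F = c `&` e); first exact: (set_algebra_setI algEa).
  apply/seteqP; split=> x; rewrite /F /=; have := ae x;
    have [] := pselect (c x); have [] := pselect (e x);
    have [] := pselect (b x); tauto.
have [F' [finF' sF' saF'] FB] := cut_b _ _ Ea crit.
apply: (irr a Ea).
(* On [F'] the set [a] agrees with [c] if [b] contains [F'], and with [e] if [b] misses it. *)
have [y [sy ay]] : exists y, sa B (E `\ a) y /\ a `&` F' = y `&` F'.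
  case: FB => FB; [exists c|exists e]; split=> //; apply/seteqP.
    split=> x /= [h F'x]; have := FB x F'x; have := ae x; tauto.
  have nb x : F' x -> ~ b x by move=> F'x bx; rewrite -[False]/(set0 x) -FB.
  by split=> x /= [h F'x]; have := nb x F'x; have := ae x; tauto.
have e' : (a `\` F') `|` (y `&` F') = a.
  by rewrite -ay; apply/seteqP; split=> x /=; have [] := pselect (F' x); tauto.
rewrite -[X in sa _ _ X]e'.
by apply: (set_algebra_setU algEa) => //; exact: (set_algebra_setI algEa).
Qed.

(** [F a] is a minimal critical set. Countably many of these finite sets meet at a point, so a
    function of that point can bound them all. *)
Lemma exists_local_critical B E : set_algebra B -> irredundant B E ->
  exists F : set W -> set W,
    (forall a F0, E a -> critical B E a F0 -> critical B E a (F a)) /\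
    (forall x, countable [set a | [/\ E a, critical B E a (F a) & F a x]]).
Proof.
move=> algB [EB irr].
have Fex a : exists F, (exists F0, critical B E a F0) ->
    critical B E a F /\ forall G, critical B E a G -> G `<=` F -> G = F.
  have [[F0 crit]|no] := pselect (exists F0, critical B E a F0);
    last by exists set0.
  have [|F [_ critF Fmin]] := finite_minimal _ crit; first by case: crit.
  by exists F.
have [F FP] := choice Fex.
exists F; split=> [a F0 Ea crit|x]; first by apply: (FP a _).1; exists F0.
(* If no finite set generated by [E] contains [x], then no critical set does. *)
have [[P0 [finP0 sP0 P0x]]|no] :=
    pselect (exists P0, [/\ finite_set P0, sa B E P0 & P0 x]); last first.
  apply: sub_countable (@countable0 (set W)); apply: subset_card_le.
  move=> a [Ea [finF sF _] Fx]; apply: no; exists (F a); split=> //.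
  by apply: saS sF; exact: subDsetl.
(* [P] is the least finite set generated by [E] that contains [x].  If [a] is
   not in the finite support [G] of [P], then [a] does not cut [P], and
   [F a `\` P] contradicts the minimality of [F a]. *)
have [//|P [PP0 [sP Px] Pmin]] :=
  @finite_minimal _ (fun P => sa B E P /\ P x) _ finP0.
have finP := sub_finite_set PP0 finP0.
have [G [finG GE sGP]] := sa_finite_support algB EB sP.
apply: (finite_set_countable (sub_finite_set _ finG)) => a [Ea crit Fx].
apply: contrapT => nGa.
have algE := set_algebra_sa algB EB.
have EaB : E `\ a `<=` B by apply: subset_trans EB; exact: subDsetl.
have algEa := set_algebra_sa algB EaB.
have saP : sa B (E `\ a) P.
  apply: saS sGP => g Gg; split; first exact: GE.
  by move=> ga; apply: nGa; rewrite -ga.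
have saPa : sa B (E `\ a) (P `&` a).
  have sEa : sa B E a by exact: sub_sa.
  have [ax|nax] := pselect (a x).
    rewrite (Pmin (P `&` a))//; split=> //; exact: (set_algebra_setI algE).
  suff -> : P `&` a = set0 by have [] := algEa.
  have Pa : P `\` a = P by apply: Pmin => //; split=> //;
    exact: (set_algebra_setD algE).
  by rewrite -Pa setDE -setIA setICl setI0.
have [finF sF saF] := crit.
have critF' : critical B E a (F a `\` P).
  split; [exact: finite_setD|exact: (set_algebra_setD algEa)|].
  rewrite (_ : a `\` (F a `\` P) = (a `\` F a) `|` (F a `&` (P `&` a))).
    by apply: (set_algebra_setU algEa) => //; exact: (set_algebra_setI algEa).
  apply/seteqP; split=> y /=; have [] := pselect (F a y);
    have [] := pselect (P y); tauto.
have [_ Fmin] := FP a (ex_intro _ _ crit).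
have : (F a `\` P) x by rewrite (Fmin _ critF').
by case.
Qed.

End Irredundant.

(** * Construction of the algebra *)

(** The singletons generate all finite and cofinite sets. *)
Lemma finite_cofinite_card_le (W : Type) : infinite_set [set: W] ->
  finite_cofinite W #<= [set: W].
Proof.
move=> infW; pose S := sa setT (range (@set1 W)).
have algS : set_algebra S by exact: set_algebra_sa.
have finS (X : set W) : finite_set X -> S X.
  move=> /(@finite_seqP {classic W})[s ->]; elim: s => [|x s IH].
    by rewrite set_nil; have [] := algS.
  rewrite (_ : [set` x :: s] = [set x] `|` [set` s]).
    apply: (set_algebra_setU algS) => //.
    by apply: sub_sa; exists x.
  apply/seteqP; split=> y /=; rewrite inE.
    by move=> /orP[/eqP|]; [left|right].
  by case=> [->|->]; rewrite ?eqxx ?orbT.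
apply: (@card_le_trans _ _ _ S); last first.
  by apply: sa_card_le => //; exact: card_image_le.
apply: subset_card_le => X [|cX]; first exact: finS.
by rewrite -[X]setCK; apply: (set_algebra_setC algS); exact: finS.
Qed.

(** * A well-ordered family of functions that dominates everywhere *)

Section Scale.
Variables (d : Order.disp_t) (W : orderType d).
Hypothesis omega1 : is_omega1 W.

Lemma d_number_ge : [set: W] #<= d_number W.
Proof.
by have [/(d_number_gt omega1)|] := card_le_total (d_number W) [set: W].
Qed.

Lemma d_number_infinite : infinite_set (d_number W).
Proof. by move=> /(card_le_finite d_number_ge); exact: omega1_infinite. Qed.

(** The index set is a dominating family of size d, well-ordered with small segments. As d is at
    least aleph_1, an index can code a constant [v] along with a function [f]; the maximum of the
    two turns domination off a countable set into domination everywhere. *)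
Lemma exists_scale : exists (I : Type) (lt : I -> I -> Prop) (g : I -> W -> W),
  [/\ well_founded lt, total_lt lt, [set: I] #= d_number W,
      forall i, ~ (d_number W #<= i |` [set j | lt j i]) &
      forall h : W -> W, exists i, forall x, h x <= g i x].
Proof.
have infD := d_number_infinite.
have [lt [wf tot segD]] := exists_initial_well_order (d_number W).
have /card_eqPle[ID DI] := card_setT (d_number W).
have [w0 _] := omega1_inhabited omega1.
have [f0 Df0] := infinite_setN0 infD.
have [pi piP] : exists pi : (W -> W) -> W * (W -> W),
    [set: W] `*` d_number W `<=` pi @` d_number W.
  apply: (card_le_surj_in (w0, f0)); apply: card_le_trans (card_le_square infD).
  by apply: card_leX => //; exact: d_number_ge.
pose g (i : d_number W) x := Order.max (pi (val i)).1 ((pi (val i)).2 x).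
exists (d_number W), lt, g; split=> // [i Di|h].
  apply: (segD i); apply: card_le_trans ID _; apply: (card_le_trans Di).
  apply: infinite_setU1_card_le => fin.
  by apply: infD; apply: (card_le_finite Di); rewrite finite_setU;
    split => //; exact: finite_set1.
have [f Df hf] := (d_numberP W).1 h.
(* [u] lies above all exceptional points, and [v] above the values of [h] up to [u]. *)
have [u uP] := omega1_bounded omega1 hf.
have [v vP] := omega1_bounded omega1
  (card_le_trans (card_image_le h _) (omega1_countable_le omega1 u)).
have [k Dk kE] := piP (v, f) (conj Logic.I Df).
exists (SigSub (mem_set Dk)) => x /=; rewrite /g kE /= le_max.
have [hx|fx] := leP (h x) (f x); first by rewrite orbT.
by rewrite ltW//; apply: vP; exists x => //=; exact/ltW/uP.
Qed.

End Scale.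

(** * Cofinality of the index set and the stages of the algebra *)

Section Construction.
Variables (d : Order.disp_t) (W : orderType d).
Hypothesis omega1 : is_omega1 W.
Variables (I : Type) (lt : I -> I -> Prop) (g : I -> W -> W).
Hypotheses (wf : well_founded lt) (tot : total_lt lt).
Hypothesis seg_lt_d : forall i, ~ (d_number W #<= i |` [set j | lt j i]).
Hypothesis g_dom : forall h : W -> W, exists i, forall x, h x <= g i x.

Lemma le_star_of_le (f h : W -> W) : (forall x, f x <= h x) -> le_star f h.
Proof.
move=> fh; rewrite /le_star (_ : [set x | _] = set0) ?countable0//.
by apply/seteqP; split=> // x /=; rewrite ltNge fh.
Qed.

Lemma le_star_le (f h k : W -> W) : le_star f h -> (forall x, h x <= k x) ->
  le_star f k.
Proof.
move=> fh hk; apply: sub_countable fh; apply: subset_card_le => x /=.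
exact: le_lt_trans (hk x).
Qed.

(** The functions [g j] with [j] up to [i] are fewer than d, so they do not form a dominating
    family. *)
Lemma exists_not_dominated i : exists f : W -> W,
  forall j, j = i \/ lt j i -> ~ le_star f (g j).
Proof.
apply: contrapT => nex; apply: (@seg_lt_d i).
apply: card_le_trans (card_image_le g _).
apply: (d_numberP W).2 => f; apply: contrapT => nf; apply: nex.
exists f => j ji fj; apply: nf; exists (g j) => //; by exists j.
Qed.

(** Dominating also a function that escapes every [g j] with [j] up to [i] forces the index beyond
    [i]. *)
Lemma g_dom_above i (h : W -> W) : exists j, lt i j /\ forall x, h x <= g j x.
Proof.
have [f fP] := exists_not_dominated i.
have [j jP] := g_dom (fun x => Order.max (h x) (f x)).
exists j; split=> [|x]; last by have := jP x; rewrite ge_max => /andP[].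
have fj : le_star f (g j).
  by apply: le_star_of_le => x; have := jP x; rewrite ge_max => /andP[].
have [ij|/tot[//|ji]] := pselect (i = j).
  by case: (fP j); [left|].
by case: (fP j); [right|].
Qed.

(** The index order has cofinality at least b: attach to each [e] a function escaping all [g j] up
    to [r e]. Fewer than b such functions have a common bound, and a [g i] above that bound cannot
    have [i] below any [r e]. *)
Lemma small_bounded_rank T (E : set T) (r : T -> I) : ~ (b_number W #<= E) ->
  exists i, forall e, E e -> r e = i \/ lt (r e) i.
Proof.
move=> nbE; have [f fP] := choice exists_not_dominated.
have [h hP] : exists h, forall k, [set f (r e) | e in E] k -> le_star k h.
  apply: contrapT => unb; apply: nbE.
  apply: card_le_trans (card_image_le (f \o r) E).
  apply: (least_cardP _).2 => //.
  by exists [set f (r e) | e in E].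
have [i iP] := g_dom h; exists i => e Ee.
have [->|/tot[|ire]] := pselect (r e = i); [by left|by right|].
case: (fP (r e) i); first by right.
by apply: le_star_le iP; apply: hP; exists e.
Qed.

Variable b : I -> set W.

Definition generated (J : set I) : set (set W) :=
  sa setT (finite_cofinite W `|` b @` J).

Lemma set_algebra_generated J : set_algebra (generated J).
Proof. exact: set_algebra_sa. Qed.

Lemma generatedS J J' : J `<=` J' -> generated J `<=` generated J'.
Proof. by move=> JJ'; apply: saS; apply: setUS; exact: image_subset. Qed.

Lemma finite_cofinite_generated J : finite_cofinite W `<=` generated J.
Proof. by move=> p Ap; apply: sub_sa; left. Qed.

Lemma generator_generated (J : set I) i : J i -> generated J (b i).
Proof. by move=> Ji; apply: sub_sa; right; exists i. Qed.

Lemma adjoin_generated i (J : set I) : [set j | lt j i] `<=` J -> J i ->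
  adjoin (generated [set j | lt j i]) (b i) `<=` generated J.
Proof.
move=> sJ Ji _ [c [e [/(generatedS sJ) Jc /(generatedS sJ) Je ->]]].
have algJ := set_algebra_generated J.
apply: (set_algebra_setU algJ); [apply: (set_algebra_setI algJ)|
  apply: (set_algebra_setD algJ)] => //; exact: generator_generated.
Qed.

(** The stages increase with [i], so a difference of two elements can be formed at the later of
    their stages. *)
Lemma generated_decomp J p : generated J p -> finite_cofinite W p \/
  exists2 i, J i & adjoin (generated [set j | lt j i]) (b i) p.
Proof.
move: p; suff : generated J `<=` [set p | finite_cofinite W p \/
  exists2 i, J i & adjoin (generated [set j | lt j i]) (b i) p] by [].
have [A0 AT _ _ _] := set_algebra_finite_cofinite W.
have alg i := set_algebra_adjoin (b i) (set_algebra_generated [set j | lt j i]).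
have sA i : finite_cofinite W `<=` adjoin (generated [set j | lt j i]) (b i).
  by move=> p Ap; apply: sub_adjoin; exact: finite_cofinite_generated.
have up i j : lt i j -> adjoin (generated [set k | lt k i]) (b i) `<=`
    adjoin (generated [set k | lt k j]) (b j).
  move=> ij p Rp; apply: sub_adjoin; apply: adjoin_generated Rp => // k ki.
  exact: wf_total_trans ki ij.
apply: sa_min => //; last first.
  move=> p [Ap|[i Ji <-]]; [by left|right].
  by exists i => //; apply: adjoin_self; exact: set_algebra_generated.
apply: set_algebraDI; [by left|by left|].
move=> p q [Ap|[i Ji Rp]] [Aq|[j Jj Rq]].
- by left; exact: (set_algebra_setD (set_algebra_finite_cofinite W)).
- by right; exists j => //; apply: (set_algebra_setD (alg j)) => //; exact: sA.
- by right; exists i => //; apply: (set_algebra_setD (alg i)) => //; exact: sA.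
right; have [ij|/tot[ij|ji]] := pselect (i = j).
- by rewrite -ij in Rq; exists i => //; exact: (set_algebra_setD (alg i)).
- by exists j => //; apply: (set_algebra_setD (alg j)) => //; exact: up Rp.
- by exists i => //; apply: (set_algebra_setD (alg i)) => //; exact: up Rq.
Qed.

Definition saturated (h : W -> W) (c : set W) : Prop :=
  forall x y, x <= h y -> y <= h x -> c x -> c y.

(** Both pieces must be uncountable although [X] is only infinite; this keeps countably infinite
    sets out of the next stage. *)
Definition splits_infinite (C : set (set W)) (c : set W) : Prop :=
  forall X, C X -> infinite_set X ->
    ~ countable (X `&` c) /\ ~ countable (X `\` c).

(** In the normal form at stage [i], an infinite [c] or [e] leaves an uncountable piece in [p]; if
    both are finite, so is [p]. *)
Lemma generated_uncountable J p :
  (forall i, J i -> splits_infinite (generated [set j | lt j i]) (b i)) ->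
  generated J p -> infinite_set p -> ~ countable p.
Proof.
have [_ uncW _] := omega1.
move=> Jsplit.
move=> /generated_decomp[[//|cp] _ ctp|[i Ji [c [e [gc ge ->]]]] infp ctp].
  by apply: uncW; rewrite -(setUv p); apply: countableU => //;
    exact: finite_set_countable.
have [finc|infc] := pselect (finite_set c); last first.
  apply: (Jsplit i Ji c gc infc).1; apply: sub_countable ctp.
  by apply: subset_card_le; exact: subsetUl.
have [fine|infe] := pselect (finite_set e); last first.
  apply: (Jsplit i Ji e ge infe).2; apply: sub_countable ctp.
  by apply: subset_card_le; exact: subsetUr.
apply: infp; rewrite finite_setU; split; first exact: finite_setIl.
exact: finite_setD.
Qed.

Lemma generated_card_le U (K : set U) J : [set: W] #<= K -> J #<= K ->
  generated J #<= K.
Proof.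
move=> WK JK; have infW := omega1_infinite omega1.
have infK : infinite_set K by move=> /(card_le_finite WK).
apply: sa_card_le => //; apply: infinite_card_leU => //.
  exact: card_le_trans (finite_cofinite_card_le infW) WK.
exact: card_le_trans (card_image_le _ _) JK.
Qed.

End Construction.

(** The recursion refers to earlier generators only through their set [prev]. The induction then
    shows that a choice exists at each stage, since the splitting by earlier generators makes the
    infinite elements so far uncountable. *)
Lemma exists_generators (d : Order.disp_t) (W : orderType d) (I : Type)
    (lt : I -> I -> Prop) (g : I -> W -> W) :
  is_omega1 W -> d_number W #<= r_number W ->
  well_founded lt -> total_lt lt ->
  (forall i, ~ (d_number W #<= i |` [set j | lt j i])) ->
  exists b : I -> set W, forall i, saturated (g i) (b i) /\
    splits_infinite (generated b [set j | lt j i]) (b i).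
Proof.
move=> omega1 dr wf tot segd.
have [b bP] := wf_choice_rec set0 (fun i prev => [set c | saturated (g i) c /\
   splits_infinite (sa setT (finite_cofinite W `|` prev)) c]) wf.
exists b => i; elim: i / (wf i) => i _ IH; apply: bP.
pose K := [set X | generated b [set j | lt j i] X /\ infinite_set X].
have [||c [csat csplit]] := @exists_splitting_saturated _ _ omega1 K (g i).
- move=> X [gX infX]; apply: generated_uncountable gX infX => //.
  by move=> j ji; exact: (IH j ji).2.
- move=> rK; apply: (segd i).
  have Kgen : K #<= generated b [set j | lt j i].
    by apply: subset_card_le => X [].
  have := card_le_trans dr (card_le_trans rK Kgen).
  (* The algebra before stage [i] is no larger than the segment or aleph_1, whichever is larger, and
     both are below d. *)
  have [segW|Wseg] := card_le_total [set j | lt j i] [set: W].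
    move=> /card_le_trans/(_ (generated_card_le omega1 b (card_lexx _) segW)).
    by move=> /(d_number_gt omega1).
  move=> /card_le_trans/(_ (generated_card_le omega1 b Wseg (card_lexx _))).
  by move=> /card_le_trans; apply; apply: subset_card_le; exact: subsetUr.
by exists c; split=> // X gX infX; exact: csplit.
Qed.

Theorem theorem3p10 (d : Order.disp_t) (W : orderType d) :
  is_omega1 W ->
  d_number W #<= r_number W ->
  exists B : set (set W),
    [/\ dichotomous B,
        proper_subalgebra (finite_cofinite W) B,
        proper_subalgebra B [set: set W],
        B #= d_number W &
        b_number W #<= irr_mm B].
Proof.
move=> omega1 dr; have infW := omega1_infinite omega1.
have [I [lt [g [wf tot ID segd gdom]]]] := exists_scale omega1.
have [b bP] := exists_generators g omega1 dr wf tot segd.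
have bsplit i := (bP i).2.
have [i0 _] : exists i0 : I, True.
  have [w0 _] := omega1_inhabited omega1.
  by have [i0 _] := gdom (fun=> w0); exists i0.
pose B := generated b setT.
have algB : set_algebra B by exact: set_algebra_generated.
have uncB p : B p -> infinite_set p -> ~ countable p.
  by apply: (generated_uncountable omega1 wf tot) => i _.
have genB J : generated b J `<=` B by exact: generatedS.
have subAB : subalgebra (finite_cofinite W) B.
  by split;
    [exact: set_algebra_finite_cofinite|exact: finite_cofinite_generated].
have dichB : dichotomous B.
  split=> // p Bp; have [|infp] := pselect (finite_set p); first by left; left.
  have [|infcp] := pselect (finite_set (~` p)); first by left; right.
  right; split; apply/(omega1_uncountableP omega1); apply: uncB => //.
  exact: (set_algebra_setC algB).
have unc_b i : ~ countable (b i) /\ ~ countable (~` b i).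
  have [_ gT _ _ _] := set_algebra_generated b [set j | lt j i].
  by have := bsplit i setT gT infW; rewrite setTI setTD.
exists B; split=> //.
- split=> // AB; have [unc uncC] := unc_b i0.
  have : B (b i0) by exact: generator_generated.
  by rewrite -AB => -[/finite_set_countable|/finite_set_countable].
(* The range of an injective sequence is countably infinite, so it is not in [B]. *)
- split=> // BT; have [w0 _] := omega1_inhabited omega1.
  have [f [_ finj]] := card_le_inj_in w0 ((infiniteP _).1 infW).
  have infrf : infinite_set (range f).
    apply/infiniteP; apply: (@inj_in_card_le _ _ f) => [n _|];
      [by exists n|exact: finj].
  by apply: (uncB _ _ infrf); [rewrite BT|exact: card_image_le].
- have /card_eqPle[ID' DI] := ID.
  apply/card_eqPle; split.
    apply: card_le_trans ID'; apply: (generated_card_le omega1) => //.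
    exact: card_le_trans (d_number_ge omega1) DI.
  apply: card_le_trans DI _; apply: (@inj_in_card_le _ _ b) => [i _|].
    exact: generator_generated.
  (* A later generator splits each earlier one, so the generators are distinct. *)
  have ltb i j : lt i j -> b i <> b j.
    move=> ij e; have gb : generated b [set k | lt k j] (b i).
      exact: generator_generated.
    have infb : infinite_set (b i) by move=> /finite_set_countable;
      exact: (unc_b i).1.
    by have [_] := bsplit j (b i) gb infb; rewrite e setDv; apply;
      exact: countable0.
  move=> i j _ _ bij; apply: contrapT => /tot[/ltb//|/ltb]; apply.
  by rewrite bij.
have [E0 maxE0] := exists_maximal_irredundant algB.
have [[irrE maxE] _] : maximal_irredundant B (irr_mm B) /\
    forall E', maximal_irredundant B E' -> irr_mm B #<= E'.
  by apply: least_cardP; exists E0.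
move: (irr_mm B) irrE maxE => E irrE maxE.
apply: contrapT => nbE.
have EB := irrE.1.
(* [r e] is a stage by which [e] is generated, with the arbitrary value [i0] outside [B]. *)
have /choice[r rP] e : exists i, B e -> generated b [set j | j = i \/ lt j i] e.
  have [Be|nBe] := pselect (B e); last by exists i0.
  have [Ae|[i _ Re]] := generated_decomp wf tot Be.
    by exists i0 => _; exact: finite_cofinite_generated.
  exists i => _; apply: (adjoin_generated _ _ Re); [by move=> j; right|by left].
have [i1 i1P] := small_bounded_rank tot segd gdom r nbE.
have [F [FP Floc]] := exists_local_critical algB irrE.
have [h hP] : exists h : W -> W, forall x a y, E a -> critical B E a (F a) ->
    F a x -> F a y -> y <= h x.
  suff /choice[h hP] : forall x, exists u, forall a y, E a ->
      critical B E a (F a) -> F a x -> F a y -> y <= u by exists h.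
  move=> x.
  have [|u uP] := @omega1_bounded _ _ omega1
      (\bigcup_(a in [set a | [/\ E a, critical B E a (F a) & F a x]]) F a).
    by apply: bigcup_countable => // a [_ [finF _ _] _];
      exact: finite_set_countable.
  by exists u => a y Ea crit Fx Fy; apply/ltW/uP; exists a.
(* This stage comes after all of [E], and [g i] is above [h]. *)
have [i [i1i hi]] := g_dom_above tot segd gdom i1 h.
have EBi : E `<=` generated b [set j | lt j i].
  move=> e Ee; apply: generatedS (rP e (EB _ Ee)) => j jr.
  have ri1 : lt (r e) i.
    by case: (i1P e Ee) => [->//|ri]; exact: wf_total_trans ri i1i.
  by case: jr => [->//|jr]; exact: wf_total_trans jr ri1.
have Bbi : B (b i) by exact: generator_generated.
have sE X : sa B E X -> generated b [set j | lt j i] X.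
  rewrite sa_saT//; apply: sa_min => //; exact: set_algebra_generated.
have splitE X : sa B E X -> infinite_set X ->
    ~ countable (X `&` b i) /\ ~ countable (X `\` b i).
  by move=> /sE; exact: bsplit.
apply: (maxE (b i |` E)).
  apply: irredundant_setU1 => // [X sX infX|a F0 Ea critF0].
    have [u1 u2] := splitE X sX infX.
    by split; apply/set0P/eqP => e0; [apply: u1|apply: u2]; rewrite e0;
      exact: countable0.
  have critF := FP a F0 Ea critF0.
  exists (F a) => //.
  (* Any two points of [F a] are related through [h], hence through [g i], so saturation puts all of
     [F a] into [b i] as soon as one point is there. *)
  have [[x [Fx bx]]|no] := pselect (F a `&` b i !=set0); [left|right].
    move=> y Fy; apply: (bP i).1 bx.
      by apply: le_trans (hi y); apply: hP Fy Fx.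
    by apply: le_trans (hi x); apply: hP Fx Fy.
  by apply/eqP; rewrite -(negbK (_ == _)); apply/negP => /set0P.
split=> [e Ee|sub]; first by right.
(* The extension is proper, as [b i] cannot split itself. *)
have Eb : E (b i) by apply: sub; left.
have infb : infinite_set (b i) by move=> /finite_set_countable;
  exact: (unc_b i).1.
have [_] := splitE (b i) (sub_sa Eb) infb.
by rewrite setDv; apply; exact: countable0.
Qed.
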